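(* Let $n\ge 1$, $k\ge 0$, $m\ge 0$ be integers. The number of plane trees with $n$ edges, $k$ internal nodes, and exactly $m$ internal nodes of degree larger than one equals $w_{n,k,m}$, where $$w_{n,k,m}=\begin{cases}\frac{1}{k}\binom{n}{k-1}\binom{n-k-1}{m-1}\binom{k}{m}, & \text{if } m>0,\ m\le k,\ k+m\le n,\\ 1, & \text{if } m=0 \text{ and } n=k,\\ 0, & \text{otherwise.}\end{cases}$$
   Context: A plane tree is a rooted tree in which the children of each vertex are linearly ordered (left to right). The degree of a vertex is its number of children. A leaf is a vertex of degree $0$; an internal node is a vertex of degree at least $1$ (the root counts as an internal node if it has children). *)

(* Defs.v *)
From mathcomp Require Import all_boot all_order all_algebra.

Set Implicit Arguments.
Unset Strict Implicit.
Unset Printing Implicit Defensive.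

Import GRing.Theory.
Local Open Scope ring_scope.

(* The children of a vertex are listed from left to right. *)
Inductive plane_tree : Type := Node of seq plane_tree.

(* The degrees of all the vertices, in preorder. *)
Fixpoint degrees (t : plane_tree) : seq nat :=
  let: Node s := t in size s :: flatten (map degrees s).

(* Each child c contributes the edge to its parent and the edges below c. *)
Fixpoint num_edges (t : plane_tree) : nat :=
  let: Node s := t in sumn (map (fun c => (num_edges c).+1) s).

Definition num_internal (t : plane_tree) : nat :=
  count (fun d => 1 <= d)%N (degrees t).

Definition num_internal_gt1 (t : plane_tree) : nat :=
  count (fun d => 1 < d)%N (degrees t).

(* Rational-valued, so that the factor 1/k is a genuine quotient. The natural
   number subtractions do not truncate where the first branch is taken. *)
Definition w (n k m : nat) : rat :=
  if [&& 0 < m, m <= k & k + m <= n]%N then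
    k%:R^-1 * 'C(n, k - 1)%:R * 'C(n - k - 1, m - 1)%:R * 'C(k, m)%:R
  else if (m == 0%N) && (n == k) then 1
  else 0.

(* Main.v *)
(* A plane tree is determined by its preorder degree word, and the words arising
   from forests of [r] trees with [N] vertices are the Lukasiewicz words.  Among
   the words of length [N] and sum [N - r], weighted by any function invariant
   under permutation of the letters, the Lukasiewicz words carry exactly the
   fraction [r / N] of the total weight.  For [r = 1] and [N = n + 1], it remains
   to count the words with sum [n], [k] nonzero letters and [m] letters larger
   than one: choose the positions of these letters, then distribute the excess
   [n - k - m] over the [m] large ones.  Finally
   ['C(n + 1, k) / (n + 1) = 'C(n, k - 1) / k]. *)

Require Import Defs.
From mathcomp Require Import all_boot all_order all_algebra.
From mathcomp Require Import all_classical.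
From mathcomp Require Import zify ring.

Import GRing.Theory.

(** * Words of given length and sum *)

Fixpoint words (N s : nat) : seq (seq nat) :=
  if N is N'.+1
  then [seq d :: v | d <- iota 0 s.+1, v <- words N' (s - d)]
  else if s == 0 then [:: [::]] else [::].

Arguments words : simpl never.

(* [r] counts the trees still to be read: [v] is the preorder degree word of a
   forest of [r] trees. *)
Fixpoint lukasiewicz r (v : seq nat) : bool :=
  if v is d :: v' then (0 < r) && lukasiewicz (r.-1 + d) v' else r == 0.

Definition has_profile k m (v : seq nat) : bool :=
  (count (fun d => 1 <= d) v == k) && (count (fun d => 1 < d) v == m).

Lemma wordsS N s :
  words N.+1 s = [seq d :: v | d <- iota 0 s.+1, v <- words N (s - d)].
Proof. by []. Qed.

Lemma mem_words N s v : (v \in words N s) = (size v == N) && (sumn v == s).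
Proof.
elim: N s v => [|N IH] s v.
  by case: s => [|s]; case: v => [|d v]; rewrite ?inE ?andbF.
rewrite wordsS; apply/allpairsPdep/andP => [[d [u [+ + ->]]]|].
  rewrite mem_iota add0n ltnS => ds; rewrite IH /= => /andP[/eqP-> /eqP->].
  by rewrite eqxx subnKC.
case: v => [|d v] [] // /eqP[sz] /eqP<-; exists d, v.
by rewrite mem_iota add0n ltnS /= leq_addr IH sz addKn !eqxx.
Qed.

Lemma uniq_words N s : uniq (words N s).
Proof.
elim: N s => [|N IH] s; first by case: s.
apply: allpairs_uniq_dep; [exact: iota_uniq | by move=> d _; apply: IH |].
by move=> [d u] [e v] _ _ /= [-> ->].
Qed.

Lemma sum_wordsS N s (P : pred (seq nat)) (f : seq nat -> nat) :
  \sum_(v <- words N.+1 s | P v) f v =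
  \sum_(d < s.+1) \sum_(v <- words N (s - d) | P (val d :: v)) f (val d :: v).
Proof.
by rewrite big_mkcond wordsS big_allpairs_dep -[iota 0 s.+1]/(index_iota 0 s.+1)
  big_mkord; apply: eq_bigr => d _; rewrite -big_mkcond.
Qed.

Lemma perm_rot_words i N s : perm_eq [seq rot i v | v <- words N s] (words N s).
Proof.
apply: uniq_perm (uniq_words N s) _ => [|v].
  by rewrite map_inj_uniq ?uniq_words //; apply: rot_inj.
have E u : (rot i u \in words N s) = (u \in words N s).
  by rewrite !mem_words size_rot !sumnE (perm_big u) // perm_rot.
apply/mapP/idP => [[u ? ->]|vw]; first by rewrite E.
by exists (rotr i v); rewrite ?rotrK // -E rotrK.
Qed.

(** * The weighted cycle lemma *)

Definition symmetric_fun (f : seq nat -> nat) :=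
  forall u v, perm_eq u v -> f u = f v.

(* Rotating words shows that each of the [N.+1] entries has the same weighted
   total as the first one. *)
Lemma sum_head_words N s (f : seq nat -> nat) : symmetric_fun f ->
  N.+1 * \sum_(v <- words N.+1 s) head 0 v * f v =
  s * \sum_(v <- words N.+1 s) f v.
Proof.
move=> fsym.
have E (i : 'I_N.+1) : \sum_(v <- words N.+1 s) head 0 v * f v =
    \sum_(v <- words N.+1 s) nth 0 v i * f v.
  rewrite -(perm_big _ (perm_rot_words i _ _)) big_map.
  apply: eq_big_seq => v; rewrite mem_words => /andP[/eqP sz _].
  rewrite (fsym _ v) ?perm_rot //; congr (_ * _).
  by rewrite -nth0 /rot nth_cat size_drop sz subn_gt0 ltn_ord nth_drop addn0.
rewrite -[X in X * _]card_ord -sum_nat_const.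
rewrite (eq_bigr _ (fun i _ => E i)) exchange_big big_distrr /=.
apply: eq_big_seq => v; rewrite mem_words => /andP[/eqP sz /eqP<-].
by rewrite -big_distrl /= sumnE (big_nth 0) sz big_mkord.
Qed.

(* Removing the first letter [d] turns [r] into [r - 1 + d]; the induction
   hypothesis then leaves the average of [d], which [sum_head_words] gives. *)
Lemma cycle_lemma N s r (f : seq nat -> nat) : symmetric_fun f -> s + r = N ->
  N * \sum_(v <- words N s | lukasiewicz r v) f v =
  r * \sum_(v <- words N s) f v.
Proof.
elim: N s r f => [|N IH] s r f fsym; first by case: r => // r; lia.
case: r => [_|r sr].
  by rewrite mul0n sum_wordsS /= big1 ?muln0 // => d _; rewrite big_pred0.
(* The tail must be nonempty: both sides get multiplied by its length so that the induction
   hypothesis applies. *)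
case: N IH sr => [|N] IH sr.
  have [-> ->] : s = 0 /\ r = 0 by lia.
  by rewrite wordsS /= !big_cons !big_nil.
have {}sr : s + r = N.+1 by lia.
apply/eqP; rewrite -(eqn_pmul2l (ltn0Sn N)); apply/eqP.
rewrite mulnCA sum_wordsS /= big_distrr /=.
have E (d : 'I_s.+1) :
    N.+1 * \sum_(v <- words N.+1 (s - d) | lukasiewicz (r + d) v) f (val d :: v) =
    (r + d) * \sum_(v <- words N.+1 (s - d)) f (val d :: v).
  apply: (IH _ _ (fun v => f (val d :: v))); last by have := ltn_ord d; lia.
  by move=> u v uv; apply: fsym; rewrite perm_cons.
rewrite (eq_bigr _ (fun d _ => E d)).
under eq_bigr => d _ do rewrite mulnDl.
rewrite big_split /= -big_distrr /= -(sum_wordsS _ _ predT).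
have -> : \sum_(d < s.+1) d * \sum_(v <- words N.+1 (s - d)) f (val d :: v) =
    \sum_(v <- words N.+2 s) head 0 v * f v.
  by rewrite sum_wordsS; apply: eq_bigr => d _; rewrite big_distrr.
(* From [s + r = N.+1] one gets [N.+2 * r + s = N.+1 * r.+1]. *)
rewrite mulnDr sum_head_words // !mulnA -mulnDl; congr (_ * _); nia.
Qed.

(** * Counting words by profile *)

(* Stars and bars: the number of weak compositions of [t] into [m] parts. *)
Definition weak_comp t m : nat :=
  if m is m'.+1 then 'C(t + m', m') else (t == 0).

(** Split by the first part [d]; for positive [m] this is the hockey-stick identity. *)
Lemma sum_weak_comp t m : \sum_(d < t.+1) weak_comp (t - d) m = weak_comp t m.+1.
Proof.
rewrite (reindex_inj rev_ord_inj) /=.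
under eq_bigr => d _ do rewrite subSS (subKn (ltn_ord d : d <= t)).
elim: t => [|t IH]; first by rewrite big_ord1; case: m => //= m; rewrite !binn.
rewrite big_ord_recr /= IH; case: m {IH} => [|m] /=; first by rewrite !bin0.
by rewrite [in RHS]addSn binS addSnnS.
Qed.

(* The number of sequences of [k] positive entries with sum [s] in which the
   entries larger than one occupy [m] prescribed positions. *)
Definition comp_gt1 s k m : nat :=
  if k + m <= s then weak_comp (s - k - m) m else 0.

(** Split by a first entry [d.+2] in a prescribed position; terms with [d] beyond the excess
    [s - k - m] vanish. *)
Lemma sum_comp_gt1 s k m :
  \sum_(d < s.+1) comp_gt1 (s - d) k m = comp_gt1 s.+2 k.+1 m.+1.
Proof.
rewrite /comp_gt1 addnS !addSn !ltnS; case: leqP => kms; last first.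
  by rewrite big1 // => d _; rewrite ifF //; lia.
have -> : s.+2 - k.+1 - m.+1 = s - k - m by lia.
rewrite -sum_weak_comp (big_ord_widen s.+1 (fun d => weak_comp (s - k - m - d) m));
  last by lia.
rewrite [RHS]big_mkcond; apply: eq_bigr => d _.
have -> : (k + m <= s - d) = (d < (s - k - m).+1) by have := ltn_ord d; lia.
by case: ifP => // _; congr weak_comp; lia.
Qed.

Lemma has_profile1 k m v :
  has_profile k m (1 :: v) = (0 < k) && has_profile k.-1 m v.
Proof. by rewrite /has_profile /=; case: k. Qed.

Lemma has_profileSS k m d v :
  has_profile k m (d.+2 :: v) = [&& 0 < k, 0 < m & has_profile k.-1 m.-1 v].
Proof. by rewrite /has_profile /=; case: k m => [|k] [|m] //=; rewrite !andbF. Qed.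

(** Split by the first letter: zero against positive is Pascal's rule for the positions of nonzero
    letters, one against larger is Pascal's rule for those of large letters. *)
Lemma sum_has_profile N s k m :
  \sum_(v <- words N s) has_profile k m v = 'C(N, k) * 'C(k, m) * comp_gt1 s k m.
Proof.
elim: N s k m => [|N IH] s k m.
  case: s => [|s].
    by rewrite big_seq1; case: k => [|k]; case: m => [|m].
  by rewrite big_nil; case: k => [|k]; case: m => [|m].
rewrite sum_wordsS.
have E0 : \sum_(v <- words N s) has_profile k m (0 :: v) =
   'C(N, k) * 'C(k, m) * comp_gt1 s k m by rewrite -IH.
case: k E0 => [|k] E0.
  rewrite big_ord_recl subn0 E0 !bin0 big1 ?addn0 // => d _.
  by rewrite big1 // => v _; rewrite /has_profile /=.
rewrite big_ord_recl subn0 E0 {E0} binS !mulnDl; congr (_ + _).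
case: s => [|s]; first by rewrite big_ord0 /comp_gt1 muln0.
rewrite big_ord_recl /= subSS subn0.
have -> : \sum_(v <- words N s) has_profile k.+1 m (1 :: v) =
   'C(N, k) * 'C(k, m) * comp_gt1 s k m.
  by rewrite -IH; apply: eq_bigr => v _; rewrite has_profile1.
have -> : comp_gt1 s k m = comp_gt1 s.+1 k.+1 m by rewrite /comp_gt1 addSn ltnS.
case: m => [|m].
  rewrite !bin0 big1 ?addn0 // => d _.
  by rewrite big1 // => v _; rewrite has_profileSS andbF.
have -> : \sum_(i < s) \sum_(v <- words N (s.+1 - bump 0 (bump 0 i)))
     has_profile k.+1 m.+1 (bump 0 (bump 0 i) :: v) =
   'C(N, k) * 'C(k, m) * comp_gt1 s.+1 k.+1 m.+1.
  case: s => [|s]; first by rewrite big_ord0 /comp_gt1 addSn addnS muln0.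
  rewrite -sum_comp_gt1 big_distrr; apply: eq_bigr => d _ /=.
  by rewrite -IH /bump !add1n !subSS; apply: eq_bigr => v _; rewrite has_profileSS.
by rewrite binS; ring.
Qed.

(** * Forests and their degree words *)

Definition forest_degrees (f : seq plane_tree) := flatten (map degrees f).

(** Removing the first root leaves a forest again, so induction on the word replaces induction on
    the nested type [plane_tree]. *)
Lemma forest_degrees_cons c f :
  forest_degrees (Node c :: f) = size c :: forest_degrees (c ++ f).
Proof. by rewrite /forest_degrees /= map_cat flatten_cat. Qed.

Lemma size_forest_degrees f :
  size (forest_degrees f) = sumn (map (fun t => (num_edges t).+1) f).
Proof.
move: {2}(forest_degrees f) (erefl (forest_degrees f)) => v.
elim: v f => [|d v IH] [|[c] f] //; rewrite forest_degrees_cons => -[_ /IH] /= ->.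
by rewrite map_cat sumn_cat addSn.
Qed.

Lemma lukasiewicz_forest_degrees f : lukasiewicz (size f) (forest_degrees f).
Proof.
move: {2}(forest_degrees f) (erefl (forest_degrees f)) => v.
elim: v f => [|d v IH] [|[c] f] //; rewrite forest_degrees_cons => -[_ /IH] /=.
by rewrite size_cat addnC.
Qed.

Lemma forest_degrees_inj f g :
  size f = size g -> forest_degrees f = forest_degrees g -> f = g.
Proof.
move: {2}(forest_degrees f) (erefl (forest_degrees f)) => v.
elim: v f g => [|d v IH] [|[c] f] [|[c'] g] //.
rewrite !forest_degrees_cons => -[_ fv] [sz] [szc] E.
have E' := IH (c ++ f) (c' ++ g) fv ltac:(by rewrite !size_cat szc sz) E.
have -> : c = c' by rewrite -(take_size_cat f szc) E' take_size_cat.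
by rewrite -(drop_size_cat f szc) E' drop_size_cat.
Qed.

Lemma forest_of_lukasiewicz r v :
  lukasiewicz r v -> exists2 f, size f = r & forest_degrees f = v.
Proof.
elim: v r => [|d v IH] r /=; first by move/eqP->; exists [::].
case: r => //= r /IH[f sz <-].
(* The first [d] trees read from the tail become the children of the new root. *)
exists (Node (take d f) :: drop d f); first by rewrite /= size_drop sz addnK.
by rewrite forest_degrees_cons cat_take_drop size_takel // sz leq_addl.
Qed.

Lemma sumn_lukasiewicz r v : lukasiewicz r v -> sumn v + r = size v.
Proof.
elim: v r => [|d v IH] r /=; first by move/eqP.
by case/andP => r0 /IH; lia.
Qed.

Lemma forest_degrees1 t : forest_degrees [:: t] = degrees t.
Proof. exact: cats0. Qed.

Lemma degrees_inj : injective degrees.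
Proof.
by move=> t u; rewrite -!forest_degrees1 => /forest_degrees_inj -/(_ erefl) [].
Qed.

Lemma mem_degrees n k m v :
  (exists2 t, [/\ num_edges t = n, num_internal t = k & num_internal_gt1 t = m]
            & degrees t = v) <->
  v \in [seq u <- words n.+1 n | lukasiewicz 1 u && has_profile k m u].
Proof.
rewrite mem_filter mem_words; split=> [[t [<- <- <-] <-]|].
  rewrite -forest_degrees1; have L := lukasiewicz_forest_degrees [:: t].
  have /= := size_forest_degrees [:: t]; rewrite addn0 => S.
  rewrite L S eqxx -eqSS -S -(sumn_lukasiewicz _ _ L) /= addn1 eqxx.
  by rewrite forest_degrees1 /has_profile !eqxx.
case/andP=> /andP[L /andP[/eqP kv /eqP mv]] /andP[/eqP S _].
have [[|t []] // _ tv] := forest_of_lukasiewicz _ _ L.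
have := size_forest_degrees [:: t]; rewrite tv S /= addn0 => -[->].
rewrite forest_degrees1 in tv; exists t => //.
by rewrite /num_internal /num_internal_gt1 tv.
Qed.

Lemma card_lukasiewicz_profile n k m :
  n.+1 * count (fun v => lukasiewicz 1 v && has_profile k m v) (words n.+1 n) =
  'C(n.+1, k) * 'C(k, m) * comp_gt1 n k m.
Proof.
(* The cycle lemma for [r = 1], weighted by the indicator of the profile. *)
rewrite -sum_has_profile -[RHS]mul1n -cycle_lemma ?addn1 //; last first.
  by move=> u v /permP uv; rewrite /has_profile !uv.
congr (_ * _); rewrite -sum1_count big_mkcondr /=.
by apply: eq_bigr => v _; case: has_profile.
Qed.

(** * Cardinality of the set of trees *)

Local Open Scope classical_set_scope.
Local Open Scope card_scope.

Lemma card_eq_uniq_seq (T : eqType) (L : seq T) :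
  uniq L -> [set x | x \in L] #= `I_(size L).
Proof.
case: L => [_|x0 L]; first by rewrite II0 (_ : mkset _ = set0) // -subset0.
move: (x0 :: L) => {}L UL.
have -> : [set x | x \in L] = nth x0 L @` `I_(size L).
  apply/seteqP; split=> [x /= /(nthP x0)[i iL <-]|x /= [i iL <-]].
    by exists i.
  exact: mem_nth.
apply: inj_card_eq => i j; rewrite !inE /= => iL jL /eqP.
by rewrite nth_uniq // => /eqP.
Qed.

Local Open Scope ring_scope.

Theorem theorem1p1 (n k m : nat) (hn : (1 <= n)%N) :
  exists N : nat,
    [set t : plane_tree | num_edges t = n /\ num_internal t = k
                          /\ num_internal_gt1 t = m] #= `I_N
    /\ N%:R = w n k m.
Proof.
set A := [set t | _].
set L := [seq v <- words n.+1 n | lukasiewicz 1 v && has_profile k m v].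
exists (size L); split.
  apply: (@card_eq_trans _ _ _ _ (degrees @` A)).
    by apply: card_esym; apply: inj_card_eq => t u _ _; apply: degrees_inj.
  suff -> : degrees @` A = [set v | v \in L].
    exact/card_eq_uniq_seq/filter_uniq/uniq_words.
  apply/seteqP; split=> [v [t [tn [tk tm]] tv]|v /mem_degrees[t [tn tk tm] tv]].
    by apply/mem_degrees; exists t.
  by exists t.
have n1 : n.+1%:R != 0 :> rat by rewrite Num.Theory.pnatr_eq0.
apply: (mulfI n1); rewrite -natrM size_filter card_lukasiewicz_profile /w.
case: ifP => [/and3P[m0 mk kmn]|ne].
  have k0 : k%:R != 0 :> rat by rewrite Num.Theory.pnatr_eq0; lia.
  have -> : comp_gt1 n k m = 'C(n - k - 1, m - 1).
    rewrite /comp_gt1 kmn; case: m m0 kmn {mk A L} => // m _ kmn /=.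
    by rewrite subn1; congr binomial; lia.
  (* Absorption, [n.+1 * 'C(n, k - 1) = k * 'C(n.+1, k)], trades [n.+1] for [k]. *)
  have /(congr1 (fun x => x%:R : rat)) := mul_bin_diag n.+1 (k - 1).
  rewrite /= subn1 prednK; last by lia.
  rewrite !natrM => D; apply: (mulfI k0); rewrite !mulrA -D.
  by field.
case: ifP => [/andP[/eqP-> /eqP<-]|ne'].
  by rewrite binSn bin0 /comp_gt1 addn0 leqnn !subnn !muln1 mulr1.
(* Otherwise a factor vanishes: [comp_gt1 n k m] if [n < k + m], or if [m = 0] and [k < n];
   ['C(k, m)] if [k < m]. *)
rewrite mulr0 /comp_gt1; case: leqP => kmn; last by rewrite muln0.
case: m {A L} ne ne' kmn => [|m] /= ne ne' kmn.
  by rewrite (_ : (_ == _) = false) ?muln0 //; lia.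
by rewrite (@bin_small k) ?muln0 // ltnNge; move: ne; rewrite kmn andbT => ->.
Qed.
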